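(* Let $p_1$ be a probability density with respect to $\mu$ and let $p_0$ be a non-negative function on $X$ such that $p_1$ is absolutely continuous with respect to $p_0$. For $q\ge0$ let $$p_q(x)=\frac{p_1(x)^q p_0(x)^{1-q}}{\int p_1(x)^q p_0(x)^{1-q}\,\mathrm{d}\mu(x)}$$ be the generalized escort distribution. Let $0\le r\le s$, and assume that $E_q\left[\left(\log\frac{p_1}{p_0}\right)^2\right]<\infty$ for all $q\in[r,s]$. Then the integral of the Fisher information along the escort-path from $q=r$ to $q=s$ is proportional to the Jeffreys divergence between $p_r$ and $p_s$: $$(s-r)\int_r^s I(q)\,\mathrm{d}q=J(p_s,p_r)=D(p_s\|p_r)+D(p_r\|p_s).$$ In particular, with $r=0$ and $s=1$ (and $p_0$ a probability density, so that the escort distribution of index $0$ is $p_0$ itself), $$\int_0^1 I(q)\,\mathrm{d}q=J(p_1,p_0)=D(p_1\|p_0)+D(p_0\|p_1).$$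
   Context: $\mu$ is a general measure on a set $X$; all densities are densities with respect to $\mu$. $D(f\|g)=\int f\log\frac{f}{g}\,\mathrm{d}\mu$ is the Kullback-Leibler divergence, with the conventions $0\log0=0\log(0/a)=0\log(0/0)=0$, and $J(f,g)=D(f\|g)+D(g\|f)$ is the Jeffreys divergence. $E_q[h]=\int h(x)p_q(x)\,\mathrm{d}\mu(x)$; writing $p_q$ or $E_q$ presupposes $\int p_1^qp_0^{1-q}\,\mathrm{d}\mu<\infty$. ''$p_1$ absolutely continuous with respect to $p_0$'' means $p_1=0$ $\mu$-almost everywhere where $p_0=0$. The product $p_1^qp_0^{1-q}$ is taken to be $0$ where $p_0=p_1=0$. The escort-path is the curve $q\mapsto p_q$. The Fisher information with respect to $q$ is $I(q)=\int\frac{1}{p_q(x)}\left(\frac{\mathrm{d}p_q(x)}{\mathrm{d}q}\right)^2\mathrm{d}\mu(x)$, the integrand being $0$ where $p_q=0$ (derivatives at $q=0$ being one-sided). *)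

(* Defs.v *)
From HB Require Import structures.
From mathcomp Require Import all_boot all_order all_algebra.
From mathcomp Require Import all_classical all_reals all_analysis.

Set Implicit Arguments.
Unset Strict Implicit.
Unset Printing Implicit Defensive.

Import Order.TTheory GRing.Theory Num.Theory.
Import numFieldNormedType.Exports.

Local Open Scope classical_set_scope.
Local Open Scope ring_scope.

Section Divergences.
Context {d : measure_display} {T : measurableType d} {R : realType}.
Variable mu : {measure set T -> \bar R}.

Definition nonneg_measurable (f : T -> R) : Prop :=
  measurable_fun setT f /\ forall x, 0 <= f x.

Definition prob_density (f : T -> R) : Prop :=
  nonneg_measurable f /\ (\int[mu]_x (f x)%:E = 1)%E.

Definition abs_cont (f g : T -> R) : Prop :=
  {ae mu, forall x, g x = 0 -> f x = 0}.

(* The logarithm of f/g with values in [-oo, +oo], for f, g >= 0.  As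
   0^-1 = +oo and 0 * +oo = 0 in \bar R, it is +oo where f > 0 = g and -oo
   where f = 0; a product by f x = 0 vanishes, as 0 * -oo = 0. *)
Definition log_ratio (f g : T -> R) (x : T) : \bar R :=
  lne ((f x)%:E / (g x)%:E)%E.

Definition KL (f g : T -> R) : \bar R :=
  (\int[mu]_x ((f x)%:E * log_ratio f g x))%E.

Definition Jeffreys (f g : T -> R) : \bar R := (KL f g + KL g f)%E.

End Divergences.

Section Escort.
Context {d : measure_display} {T : measurableType d} {R : realType}.
Variables (mu : {measure set T -> \bar R}) (p1 p0 : T -> R).

(* With powR, 0 `^ 0 = 1 and 0 `^ a = 0 for every a != 0.  So this is p0 x at
   q = 0 and p1 x at q = 1, and it is 0 for every q where p0 = p1 = 0.  The
   set where p0 = 0 < p1 and q > 1 (value 0 rather than +oo) is negligible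
   when abs_cont mu p1 p0. *)
Definition escort_weight (q : R) (x : T) : R := p1 x `^ q * p0 x `^ (1 - q).

Definition escort_mass (q : R) : \bar R :=
  (\int[mu]_x (escort_weight q x)%:E)%E.

(* Meaningful only when escort_mass q < +oo. *)
Definition escort (q : R) (x : T) : R :=
  escort_weight q x / fine (escort_mass q).

Definition escort_mean (h : T -> \bar R) (q : R) : \bar R :=
  (\int[mu]_x (h x * (escort q x)%:E))%E.

(* The moment hypothesis at q, with the finiteness of the normalizing integral
   that it presupposes.  The squared log-ratio is +oo where p1 = 0 < p0, which
   matters only at q = 0, since escort q vanishes there when q > 0. *)
Definition finite_log_moment2 (q : R) : Prop :=
  (escort_mass q < +oo)%E /\
  (escort_mean (fun x => log_ratio p1 p0 x ^+ 2)%E q < +oo)%E.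

(* The parameter ranges over [0, +oo[: two-sided derivative at q > 0,
   right derivative at q = 0. *)
Definition param_derive (f : R -> R) (q : R) : R :=
  if 0 < q then derive1 f q
  else lim (h^-1 * (f (q + h) - f q) @[h --> 0^'+]).

Definition fisher_info (q : R) : \bar R :=
  (\int[mu]_x
    (if escort q x == 0%R then 0%R
     else (escort q x)^-1 * param_derive (escort ^~ x) q ^+ 2)%R%:E)%E.

End Escort.

(* Main.v *)
(* On {p1 > 0}, with w = p0 and L = log (p1 / p0), the weight p1^q p0^(1-q) is
   w exp (q L): the escort path is an exponential family with potential L.
   Hence d p_q / dq = p_q (L - E_q L), I(q) = Var_q L = d (E_q L) / dq, and
   the integral of I over [r, s] is E_s L - E_r L, whereas
   J(p_s, p_r) = int (p_s - p_r) log (p_s / p_r) = (s - r) (E_s L - E_r L).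
   All moments are differentiated under the integral sign, with the dominating
   function |L|^k w (exp (r L) + exp (s L)). *)
Require Import Defs.
From HB Require Import structures.
From mathcomp Require Import all_boot all_order all_algebra.
From mathcomp Require Import all_classical all_reals all_analysis.
From mathcomp Require Import measurable_realfun ring lra.
Import Order.TTheory GRing.Theory Num.Theory.
Import numFieldNormedType.Exports.
Local Open Scope classical_set_scope.
Local Open Scope ring_scope.

(** * Continuity and integration on a real interval *)

Lemma within_continuousV_itv (R : realType) (a b : R) (f : R -> R) : a < b ->
  {within `[a, b], continuous f} -> (forall x, x \in `[a, b] -> f x != 0) ->
  {within `[a, b], continuous (fun x => (f x)^-1)}.
Proof.
move=> ab /(continuous_within_itvP _ ab)[fo fa fb] f0.
apply/(continuous_within_itvP _ ab); split.
- move=> x xab; apply: cvgV; last exact: fo.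
  by apply: f0; exact: subset_itv_oo_cc.
- by apply: cvgV => //; apply: f0; rewrite in_itv/= lexx ltW.
- by apply: cvgV => //; apply: f0; rewrite in_itv/= lexx ltW.
Qed.

(** A single point is Lebesgue-null. Measurability of [f] is derived rather than assumed: on the
    open interval [f] is [g] with one value changed. *)
Lemma integral_itv_eq_off_point (R : realType) (a b c : R) (f g : R -> \bar R) :
  measurable_fun `]a, b[ g ->
  (forall x, x \in `]a, b[ -> x != c -> f x = g x) ->
  (\int[lebesgue_measure]_(x in `[a, b]) f x =
   \int[lebesgue_measure]_(x in `[a, b]) g x)%E.
Proof.
move=> mg fg; have mf : measurable_fun `]a, b[ f.
  apply: (@eq_measurable_fun _ _ _ _ _ (fun x => if x == c then f c else g x)).
    move=> x; rewrite inE/= => xab.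
    by have [->//|xc] := eqVneq x c; rewrite fg.
  apply: measurable_fun_if => //; first exact: measurable_fun_eqr.
  by apply: measurable_funS mg => //; exact: subIsetl.
rewrite integral_itv_bndoo// [RHS]integral_itv_bndoo//.
apply: ae_eq_integral => //; exists [set c]; split => //.
  exact: lebesgue_measure_set1.
move=> x /=; apply: contra_notP => /eqP xc xab.
by apply: fg.
Qed.

(** * Moments of [L] under the exponentially tilted weight [w exp (q L)] *)

Section TiltedMoments.
Context {d : measure_display} {T : measurableType d} {R : realType}.
Variables (mu : {measure set T -> \bar R}) (w L : T -> R).
Hypothesis mw : measurable_fun setT w.
Hypothesis mL : measurable_fun setT L.

(** The [k]-th derivative in [q] of [w exp (q L)]. Thus [moment 0] is the partition function, and
    [moment k] is formally its [k]-th derivative. *)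
Definition tilt (k : nat) (q : R) (x : T) : R :=
  L x ^+ k * (w x * expR (q * L x)).

Definition moment (k : nat) (q : R) : R := \int[mu]_x tilt k q x.

Lemma measurable_tilt k q : measurable_fun setT (tilt k q).
Proof.
apply: measurable_funM; first exact: measurable_funX.
apply: measurable_funM => //; apply: measurableT_comp => //.
exact: measurable_funM.
Qed.

Lemma integral_tilt k q : mu.-integrable setT (EFin \o tilt k q) ->
  (\int[mu]_x (tilt k q x)%:E = (moment k q)%:E)%E.
Proof. by move=> ik; rewrite fineK//; exact: integrable_fin_num. Qed.

Lemma is_derive_tilt k (q : R) x : is_derive q 1 ((tilt k) ^~ x) (tilt k.+1 q x).
Proof.
rewrite /tilt; apply: is_derive_eq.
by rewrite /GRing.scale/= exprS; ring.
Qed.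

(** For fixed [x], [exp (q L)] is monotone in [q], with direction given by the sign of [L x], so its
    value at [q] is at most its value at one of the endpoints. The sum of both is a bound uniform in
    [q]. *)
Lemma normr_tilt_le k r s q x : r <= q <= s ->
  `|tilt k q x| <= `|tilt k r x| + `|tilt k s x|.
Proof.
move=> /andP[rq qs]; rewrite /tilt !normrM -!mulrDr.
do 2 rewrite ler_wpM2l//.
rewrite !gtr0_norm ?expR_gt0//.
have [L0|L0] := leP 0 (L x).
  rewrite (@le_trans _ _ (expR (s * L x)))// ?lerDr ?expR_ge0// ler_expR.
  by rewrite ler_wpM2r.
rewrite (@le_trans _ _ (expR (r * L x)))// ?lerDl ?expR_ge0// ler_expR.
by rewrite ler_wnM2r// ltW.
Qed.

Section Integrability.
Variables r s : R.

Let tilt_bound k x := `|tilt k r x| + `|tilt k s x|.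

Lemma integrable_tilt_bound k :
  mu.-integrable setT (EFin \o tilt k r) ->
  mu.-integrable setT (EFin \o tilt k s) ->
  mu.-integrable setT (EFin \o tilt_bound k).
Proof.
move=> intr ints; rewrite (_ : EFin \o _ = (EFin \o (Num.norm \o tilt k r)) \+
  (EFin \o (Num.norm \o tilt k s)))//.
by apply: integrableD => //; exact: integrable_norm.
Qed.

Lemma integrable_tilt k q : r <= q <= s ->
  mu.-integrable setT (EFin \o tilt k r) ->
  mu.-integrable setT (EFin \o tilt k s) ->
  mu.-integrable setT (EFin \o tilt k q).
Proof.
move=> rqs intr ints; apply: le_integrable (integrable_tilt_bound k intr ints) => //.
  by apply/measurable_EFinP; exact: measurable_tilt.
by move=> x _; rewrite /= lee_fin [leRHS]ger0_norm ?addr_ge0// normr_tilt_le.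
Qed.

(** From [(|L| - 1)^2 >= 0] comes [|L| <= 1 + L^2], so the moments of order 0 and 2 control the one
    of order 1. *)
Lemma integrable_tilt1 q :
  mu.-integrable setT (EFin \o tilt 0 q) ->
  mu.-integrable setT (EFin \o tilt 2 q) ->
  mu.-integrable setT (EFin \o tilt 1 q).
Proof.
move=> i0 i2.
have := integrableD measurableT (integrable_norm i0) (integrable_norm i2).
apply: le_integrable => //.
  by apply/measurable_EFinP; exact: measurable_tilt.
move=> x _; rewrite /= lee_fin [leRHS]ger0_norm ?addr_ge0//.
rewrite /tilt !normrM -mulrDl ler_wpM2r// normrX expr1 expr0 normr1.
by have := sqr_ge0 (`|L x| - 1); nra.
Qed.

(* Clamping makes the moments bounded on an open interval containing [r, s], so
   that continuity_under_integral also gives one-sided continuity at r and s. *)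
Let clamp (q : R) := Num.max r (Num.min q s).

Lemma continuous_moment k : r < s ->
  mu.-integrable setT (EFin \o tilt k r) ->
  mu.-integrable setT (EFin \o tilt k s) ->
  {within `[r, s], continuous (moment k)}.
Proof.
move=> rs intr ints.
have clampI q : r <= clamp q <= s.
  by rewrite /clamp le_max lexx/= ge_max (ltW rs) ge_min lexx orbT.
have cclamp : continuous clamp.
  move=> q; apply: (@continuous_max _ _ (cst r) (fun q => Num.min q s)).
    exact: cvg_cst.
  by apply: (@continuous_min _ _ id (cst s)); [exact: cvg_id|exact: cvg_cst].
have ctilt y : continuous (fun q => tilt k q y).
  move=> q; apply: differentiable_continuous; apply/derivable1_diffP.
  exact: (@ex_derive _ _ _ _ _ _ _ (is_derive_tilt k q y)).
have cmc : {in `]r - 1, s + 1[%classic,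
    continuous (fun q => \int[mu]_y tilt k (clamp q) y)}.
  apply: (@continuity_under_integral _ _ _ mu (fun q => tilt k (clamp q)) setT
    measurableT _ _ _ _ (tilt_bound k)).
  - by move=> q _; exact: integrable_tilt.
  - apply: aeW => y _ q _.
    exact: (@continuous_comp _ _ _ clamp ((tilt k) ^~ y) q (cclamp q) (ctilt y _)).
  - exact: integrable_tilt_bound.
  - by move=> q _; apply: aeW => y _; exact: normr_tilt_le.
(* On [[r, s]] the clamp is the identity, so the clamped integral restricts to [moment k]. *)
apply: (@subspace_eq_continuous _ _ _
  (fun q => \int[mu]_y tilt k (clamp q) y)).
  move=> q; rewrite inE/= in_itv/= => /andP[rq qs].
  by rewrite /moment /clamp min_l// max_r.
apply: continuous_in_subspaceT => q; rewrite inE/= in_itv/= => /andP[rq qs].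
apply: cmc; rewrite inE/= in_itv/=; apply/andP; split; lra.
Qed.

Lemma is_derive_moment k (q : R) : q \in `]r, s[ ->
  mu.-integrable setT (EFin \o tilt k r) ->
  mu.-integrable setT (EFin \o tilt k s) ->
  mu.-integrable setT (EFin \o tilt k.+1 r) ->
  mu.-integrable setT (EFin \o tilt k.+1 s) ->
  is_derive q 1 (moment k) (moment k.+1 q).
Proof.
move=> qrs intr ints intr1 ints1.
have d1E p y : partial1of2 (tilt k) p y = tilt k.+1 p y.
  rewrite partial1of2E.
  exact: (@derive_val _ _ _ _ _ _ _ (is_derive_tilt k p y)).
have sub p : p \in `]r, s[ -> r <= p <= s.
  by rewrite in_itv/= => /andP[/ltW-> /ltW->].
have h1 p : `]r, s[%classic p -> mu.-integrable setT (EFin \o tilt k p).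
  by move=> /sub prs; exact: integrable_tilt.
have h2 p y : `]r, s[%classic p -> setT y -> derivable ((tilt k) ^~ y) p 1.
  by move=> _ _; exact: (@ex_derive _ _ _ _ _ _ _ (is_derive_tilt k p y)).
have h3 y : 0 <= tilt_bound k.+1 y by rewrite addr_ge0.
have h4 p y : `]r, s[%classic p -> setT y ->
    `|partial1of2 (tilt k) p y| <= tilt_bound k.+1 y.
  by move=> /sub prs _; rewrite d1E; exact: normr_tilt_le.
have ib := integrable_tilt_bound _ intr1 ints1.
apply: DeriveDef.
  exact: (derivable_under_integral measurableT qrs h1 h2 h3 ib h4).
rewrite -derive1E (differentiation_under_integral measurableT qrs h1 h2 h3 ib h4).
by apply: eq_Rintegral => y _; exact: d1E.
Qed.

(** The logarithmic derivative of the partition function, that is, the mean of [L] under the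
    normalized tilt. *)
Definition tilted_mean (q : R) : R := moment 1 q / moment 0 q.

Definition tilted_variance (q : R) : R :=
  moment 2 q / moment 0 q - tilted_mean q ^+ 2.

Hypothesis rs : r < s.
Hypothesis int0r : mu.-integrable setT (EFin \o tilt 0 r).
Hypothesis int0s : mu.-integrable setT (EFin \o tilt 0 s).
Hypothesis int2r : mu.-integrable setT (EFin \o tilt 2 r).
Hypothesis int2s : mu.-integrable setT (EFin \o tilt 2 s).
Hypothesis moment0_neq0 : forall q, r <= q <= s -> moment 0 q != 0.

Let int1r := integrable_tilt1 r int0r int2r.
Let int1s := integrable_tilt1 s int0s int2s.

(** The logarithm of the ratio of two members of the exponential family is affine in [L]; this is
    the form in which divergences are evaluated. *)
Lemma integral_tilt_affine a b q : r <= q <= s ->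
  (\int[mu]_x (tilt 0 q x / moment 0 q * (a * L x + b))%:E
   = (a * tilted_mean q + b)%:E)%E.
Proof.
move=> rqs; have Z0 := moment0_neq0 q rqs.
have i0 := integrable_tilt 0 q rqs int0r int0s.
have i1 := integrable_tilt 1 q rqs int1r int1s.
set Z := moment 0 q in Z0 *.
have E x : tilt 0 q x / Z * (a * L x + b) =
    (a / Z) * tilt 1 q x + (b / Z) * tilt 0 q x by rewrite /tilt; ring.
under eq_integral do rewrite E EFinD (EFinM (a / Z)) (EFinM (b / Z)).
rewrite integralD//; [|exact: integrableZl..].
rewrite !integralZl//.
rewrite !integral_tilt// -!EFinM -EFinD -/Z; congr EFin.
by rewrite /tilted_mean -/Z; field.
Qed.

(** The centred square is the form produced by the Fisher information; expanding it gives a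
    combination of the moments of order 0, 1 and 2. *)
Lemma integral_tilt_variance q : r <= q <= s ->
  (\int[mu]_x (tilt 0 q x / moment 0 q * (L x - tilted_mean q) ^+ 2)%:E
   = (tilted_variance q)%:E)%E.
Proof.
move=> rqs; have Z0 := moment0_neq0 q rqs.
have i0 := integrable_tilt 0 q rqs int0r int0s.
have i1 := integrable_tilt 1 q rqs int1r int1s.
have i2 := integrable_tilt 2 q rqs int2r int2s.
rewrite /tilted_variance; set m := tilted_mean q.
set Z := moment 0 q in Z0 *.
have E x : tilt 0 q x / Z * (L x - m) ^+ 2 = Z^-1 * tilt 2 q x
    + (((- 2 * m) / Z) * tilt 1 q x + (m ^+ 2 / Z) * tilt 0 q x).
  by rewrite /tilt; ring.
under eq_integral do rewrite E EFinD EFinD (EFinM Z^-1) (EFinM (- 2 * m / Z))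
  (EFinM (m ^+ 2 / Z)).
rewrite integralD//; [|exact: integrableZl|]; last first.
  by apply: integrableD => //; exact: integrableZl.
rewrite integralD//; [|exact: integrableZl..].
rewrite !integralZl//.
rewrite !integral_tilt// -!EFinM -!EFinD -/Z; congr EFin.
have -> : moment 1 q = m * Z by rewrite /m /tilted_mean divfK.
by field.
Qed.

(** Quotient rule: with [M_k] the moments, [(M_1 / M_0)' = M_2 / M_0 - (M_1 / M_0)^2]. *)
Lemma is_derive_tilted_mean (q : R) : q \in `]r, s[ ->
  is_derive q 1 tilted_mean (tilted_variance q).
Proof.
move=> qrs; have Z0 : moment 0 q != 0.
  by apply: moment0_neq0; move: qrs; rewrite in_itv/= => /andP[/ltW-> /ltW->].
have d0 := is_derive_moment 0 q qrs int0r int0s int1r int1s.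
have d1 := is_derive_moment 1 q qrs int1r int1s int2r int2s.
have dV := is_deriveV Z0 d0.
rewrite /tilted_mean; apply: is_derive_eq.
rewrite /GRing.scale/= /tilted_variance /tilted_mean; field.
exact: Z0.
Qed.

Lemma continuous_tilted_mean_variance :
  {within `[r, s], continuous tilted_mean} /\
  {within `[r, s], continuous tilted_variance}.
Proof.
have c0 := continuous_moment 0 rs int0r int0s.
have c1 := continuous_moment 1 rs int1r int1s.
have c2 := continuous_moment 2 rs int2r int2s.
have cV := within_continuousV_itv _ _ _ _ rs c0 moment0_neq0.
have cm : {within `[r, s], continuous tilted_mean}.
  by move=> x; apply: cvgM; [exact: c1|exact: cV].
split => // x; apply: cvgB; first by apply: cvgM; [exact: c2|exact: cV].
by apply: cvgM; exact: cm.
Qed.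

Lemma integral_tilted_variance :
  (\int[lebesgue_measure]_(q in `[r, s]) (tilted_variance q)%:E
   = (tilted_mean s - tilted_mean r)%:E)%E.
Proof.
have [cm cv] := continuous_tilted_mean_variance.
have /(continuous_within_itvP _ rs)[_ mr ms] := cm.
have dm : derivable_oo_LRcontinuous tilted_mean r s.
  split => // q qrs.
  exact: (@ex_derive _ _ _ _ _ _ _ (is_derive_tilted_mean q qrs)).
rewrite (continuous_FTC2 rs cv dm)// => q qrs; rewrite derive1E.
exact: (@derive_val _ _ _ _ _ _ _ (is_derive_tilted_mean q qrs)).
Qed.

End Integrability.
End TiltedMoments.

(** * The escort path as an exponential tilt *)

Section EscortTilt.
Context {d : measure_display} {T : measurableType d} {R : realType}.
Variable mu : {measure set T -> \bar R}.

Lemma log_ratioE (f g : T -> R) x : 0 <= f x -> 0 <= g x ->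
  log_ratio f g x = if f x == 0 then -oo%E else
    if g x == 0 then +oo%E else (ln (f x / g x))%:E.
Proof.
move=> f0 g0; rewrite /log_ratio inver.
have [->|fx0] := eqVneq (f x) 0; first by rewrite mul0e le0_lneNy.
have fx_gt0 : 0 < f x by rewrite lt0r fx0.
have [gx0|gx0] := eqVneq (g x) 0; first by rewrite gt0_muley// lte_fin.
by rewrite -EFinM lne_EFin// divr_gt0// lt0r gx0.
Qed.

Lemma measurable_fun_div_ge0 (f g : T -> R) : measurable_fun setT f ->
  nonneg_measurable g -> measurable_fun setT (fun x => f x / g x).
Proof.
move=> mf [mg g0].
(* For [g x >= 0] the inverse is the power of exponent [-1], also at 0, where both are 0;
   measurability of powers then applies. *)
rewrite (_ : (fun x => _) = fun x => f x * g x `^ (-1)); last first.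
  by apply/funext => x; rewrite powR_inv1.
apply: measurable_funM => //.
exact: (measurableT_comp (@measurable_powR R (-1)) mg).
Qed.

Lemma measurable_log_ratio (f g : T -> R) :
  nonneg_measurable f -> nonneg_measurable g ->
  measurable_fun setT (log_ratio f g).
Proof.
move=> [mf f0] [mg g0].
rewrite (_ : log_ratio f g = fun x => if f x == 0 then -oo%E else
    if g x == 0 then +oo%E else (ln (f x / g x))%:E); last first.
  by apply/funext => x; rewrite log_ratioE.
apply: measurable_fun_ifT => //; first exact: measurable_fun_eqr.
apply: measurable_fun_ifT => //; first exact: measurable_fun_eqr.
apply/measurable_EFinP; apply: measurableT_comp; first exact: measurable_ln.
exact: measurable_fun_div_ge0.
Qed.

Variables p1 p0 : T -> R.

(** Cutting [p0] off where [p1 = 0] makes the tilt vanish there for every [q], as [exp (q L)] never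
    does. *)
Definition escort_base (x : T) : R := if p1 x == 0 then 0 else p0 x.

(** A real-valued log-ratio: where [p1] or [p0] vanishes, the quotient is 0 and [ln 0 = 0]. This
    default is harmless since [escort_base] is 0 there. *)
Definition escort_log (x : T) : R := ln (p1 x / p0 x).

Local Notation tlt := (tilt escort_base escort_log).
Local Notation mom := (moment mu escort_base escort_log).

Hypothesis hp1 : prob_density mu p1.
Hypothesis hp0 : nonneg_measurable p0.
Hypothesis hac : abs_cont mu p1 p0.

Let mp1 : measurable_fun setT p1 := hp1.1.1.
Let p1_ge0 : forall x, 0 <= p1 x := hp1.1.2.
Let mp0 : measurable_fun setT p0 := hp0.1.
Let p0_ge0 : forall x, 0 <= p0 x := hp0.2.

Lemma measurable_escort_base : measurable_fun setT escort_base.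
Proof. by apply: measurable_fun_ifT => //; exact: measurable_fun_eqr. Qed.

Lemma measurable_escort_log : measurable_fun setT escort_log.
Proof.
apply: measurableT_comp; first exact: measurable_ln.
exact: measurable_fun_div_ge0.
Qed.

(* At q = 0 the weight does not vanish on {p1 = 0 < p0}, and at q = 1 it does not
   vanish on {p0 = 0 < p1}, while the tilt vanishes on both sets. *)
Lemma escort_weight_tilt q x :
  (q = 0 -> p1 x = 0 -> p0 x = 0) -> (q = 1 -> p0 x = 0 -> p1 x = 0) ->
  escort_weight p1 p0 q x = tlt 0 q x.
Proof.
rewrite /escort_weight /tilt /escort_base /escort_log expr0 mul1r => q0 q1.
have [p1x|p1x] := eqVneq (p1 x) 0.
  rewrite mul0r p1x; have [q00|q0'] := eqVneq q 0.
    by rewrite (q0 q00 p1x) q00 subr0 powRr0 mul1r powR0// oner_eq0.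
  by rewrite powR0// mul0r.
have [p0x|p0x] := eqVneq (p0 x) 0.
  rewrite p0x mul0r powR0 ?mulr0// subr_eq0 eq_sym.
  by apply/eqP => /q1/(_ p0x)/eqP; rewrite (negbTE p1x).
have p1x_gt0 : 0 < p1 x by rewrite lt0r p1x p1_ge0.
have p0x_gt0 : 0 < p0 x by rewrite lt0r p0x p0_ge0.
(* Writing the base factor [p0 x] as [exp (ln (p0 x))] turns both sides into single exponentials. *)
rewrite /powR (negbTE p1x) (negbTE p0x) -expRD -{2}(lnK p0x_gt0) -expRD.
by rewrite ln_div//; congr expR; ring.
Qed.

Lemma escort_weight_ge0 q x : 0 <= escort_weight p1 p0 q x.
Proof. by rewrite mulr_ge0// powR_ge0. Qed.

Lemma measurable_escort_weight q : measurable_fun setT (escort_weight p1 p0 q).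
Proof.
apply: measurable_funM.
  exact: (measurableT_comp (@measurable_powR R q) mp1).
exact: (measurableT_comp (@measurable_powR R (1 - q)) mp0).
Qed.

Lemma nonneg_measurable_escort q : nonneg_measurable (escort mu p1 p0 q).
Proof.
split=> [|x]; first by apply: measurable_funM => //; exact: measurable_escort_weight.
rewrite divr_ge0 ?escort_weight_ge0// fine_ge0// integral_ge0// => y _.
by rewrite lee_fin escort_weight_ge0.
Qed.

(** If the mass were 0, the weight would vanish almost everywhere, so [p1] or [p0] would. Absolute
    continuity then gives [p1 = 0] almost everywhere, against total mass 1. *)
Lemma escort_mass_gt0 q : (0 < escort_mass mu p1 p0 q)%E.
Proof.
rewrite lt0e; apply/andP; split; last first.
  by apply: integral_ge0 => x _; rewrite lee_fin escort_weight_ge0.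
apply/eqP => mass0.
have : ae_eq mu setT (EFin \o escort_weight p1 p0 q) (cst 0%E).
  apply/ae_eq_integral_abs => //.
    by apply/measurable_EFinP; exact: measurable_escort_weight.
  rewrite -[RHS]mass0; apply: eq_integral => x _ /=.
  by rewrite ger0_norm// escort_weight_ge0.
move=> w0; have p10 : ae_eq mu setT (EFin \o p1) (cst 0%E).
  move: w0 hac; apply: filterS2 => x /= /(_ I)[] /eqP.
  rewrite mulf_eq0 => /orP[] /eqP/powR_eq0_eq0 px0 h _ /=; first by rewrite px0.
  by rewrite (h px0).
have : (\int[mu]_x (p1 x)%:E = \int[mu]_x cst 0 x)%E.
  by apply: ae_eq_integral => //; exact/measurable_EFinP.
by rewrite hp1.2 integral0 => /eqP; rewrite onee_eq0.
Qed.

(* The squared log-ratio is +oo on {p1 = 0 < p0}, which has positive p0-mass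
   unless it is negligible. *)
Lemma null_p1_zero : finite_log_moment2 mu p1 p0 0 ->
  {ae mu, forall x, p1 x = 0 -> p0 x = 0}.
Proof.
move=> [mass_fin mom_fin]; have mass_gt0 := escort_mass_gt0 0.
pose h x := (log_ratio p1 p0 x ^+ 2 * (escort mu p1 p0 0 x)%:E)%E.
have h_ge0 x : (0 <= h x)%E.
  by rewrite mule_ge0 ?sqre_ge0// lee_fin (nonneg_measurable_escort 0).2.
have mh : measurable_fun setT h.
  apply: emeasurable_funM.
    by apply: emeasurable_funM; exact: measurable_log_ratio hp1.1 hp0.
  by apply/measurable_EFinP; exact: (nonneg_measurable_escort 0).1.
have ih : mu.-integrable setT h.
  apply/integrableP; split => //.
  by under eq_integral do rewrite gee0_abs//.
move: (integrable_ae measurableT ih); apply: filterS => x /(_ I).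
rewrite /h log_ratioE// => + p1x; rewrite p1x eqxx.
apply: contraPP => /eqP p0x.
have -> : (-oo ^+ 2 = +oo :> \bar R)%E by rewrite expe2.
have weight_gt0 : 0 < escort_weight p1 p0 0 x.
  by rewrite /escort_weight p1x powRr0 subr0 powRr1// mul1r lt0r p0x p0_ge0.
rewrite gt0_mulye// lte_fin divr_gt0// fine_gt0//.
by rewrite mass_gt0.
Qed.

(** The exceptional set at [q = 0] is negligible by the moment hypothesis, the one at [q = 1] by
    absolute continuity. *)
Lemma ae_escort_weight_tilt q : finite_log_moment2 mu p1 p0 q ->
  {ae mu, forall x, escort_weight p1 p0 q x = tlt 0 q x}.
Proof.
move=> hq; have [q0|q0] := eqVneq q 0.
  move: hac; rewrite q0 in hq *; move: (null_p1_zero hq).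
  by apply: filterS2 => x h1 h2; exact: escort_weight_tilt.
move: hac; apply: filterS => x h; apply: escort_weight_tilt => //.
by move=> q0'; rewrite q0' eqxx in q0.
Qed.

Lemma integral_escort_weight q : finite_log_moment2 mu p1 p0 q ->
  (\int[mu]_x (tlt 0 q x)%:E = escort_mass mu p1 p0 q)%E.
Proof.
move=> hq; apply: ae_eq_integral => //.
- apply/measurable_EFinP.
  exact: measurable_tilt measurable_escort_base measurable_escort_log 0 q.
- by apply/measurable_EFinP; exact: measurable_escort_weight.
- by move: (ae_escort_weight_tilt q hq); apply: filterS => x + _ /= => ->.
Qed.

Lemma moment0_escort q : finite_log_moment2 mu p1 p0 q ->
  mom 0 q = fine (escort_mass mu p1 p0 q).
Proof. by move=> hq; rewrite /moment /Rintegral integral_escort_weight. Qed.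

Lemma moment0_gt0 q : finite_log_moment2 mu p1 p0 q -> 0 < mom 0 q.
Proof.
move=> hq; rewrite moment0_escort// fine_gt0// escort_mass_gt0/=.
by case: hq.
Qed.

Lemma escort_base_ge0 x : 0 <= escort_base x.
Proof. by rewrite /escort_base; case: ifP. Qed.

Lemma integrable_tilt0 q : finite_log_moment2 mu p1 p0 q ->
  mu.-integrable setT (EFin \o tlt 0 q).
Proof.
move=> hq; apply/integrableP; split.
  apply/measurable_EFinP.
  exact: measurable_tilt measurable_escort_base measurable_escort_log 0 q.
under eq_integral => x _.
  rewrite gee0_abs; first over.
  by rewrite lee_fin /tilt expr0 mul1r mulr_ge0 ?expR_ge0// escort_base_ge0.
by rewrite integral_escort_weight//; case: hq.
Qed.

(** Up to the positive factor [1 / mom 0 q], the integral is the second moment of the hypothesis: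
    the infinite values of [log_ratio] occur only where the tilt is 0, and there the product is
    0. *)
Lemma integrable_tilt2 q : finite_log_moment2 mu p1 p0 q ->
  mu.-integrable setT (EFin \o tlt 2 q).
Proof.
move=> hq; have Z_gt0 := moment0_gt0 q hq.
have t2_ge0 x : 0 <= tlt 2 q x.
  by rewrite mulr_ge0 ?sqr_ge0// mulr_ge0 ?expR_ge0// escort_base_ge0.
have mt2 : measurable_fun setT (EFin \o tlt 2 q).
  apply/measurable_EFinP.
  exact: measurable_tilt measurable_escort_base measurable_escort_log 2 q.
apply/integrableP; split => //.
under eq_integral do rewrite gee0_abs ?lee_fin//.
have : ((mom 0 q)^-1%:E * \int[mu]_x (tlt 2 q x)%:E < +oo)%E.
  rewrite -ge0_integralZl//; last 2 first.
    by move=> x _; rewrite lee_fin.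
    by rewrite lee_fin invr_ge0 ltW.
  apply: le_lt_trans hq.2; rewrite le_eqVlt; apply/orP; left; apply/eqP.
  apply: ae_eq_integral => //.
  - exact: measurable_funeM.
  - apply: emeasurable_funM.
      by apply: emeasurable_funM; exact: measurable_log_ratio hp1.1 hp0.
    by apply/measurable_EFinP; exact: (nonneg_measurable_escort q).1.
  - move: (ae_escort_weight_tilt q hq); apply: filterS => x wx _ /=.
    rewrite /escort -moment0_escort// wx log_ratioE//.
    rewrite (_ : tlt 2 q x = escort_log x ^+ 2 * tlt 0 q x); last first.
      by rewrite /tilt expr0 mul1r.
    have t0 : escort_base x = 0 -> tlt 0 q x = 0.
      by rewrite /tilt => ->; rewrite mul0r mulr0.
    have [p1x|p1x] := eqVneq (p1 x) 0.
      by rewrite t0 ?mul0r ?mulr0 ?mule0// /escort_base p1x eqxx.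
    have [p0x|p0x] := eqVneq (p0 x) 0.
      by rewrite t0 ?mul0r ?mulr0 ?mule0// /escort_base p0x; case: ifP.
    by rewrite -!EFinM -/(escort_log x); congr EFin; ring.
(* The value [+oo] is excluded because its product with the positive factor would be [+oo]. *)
case: (\int[mu]_x _)%E => [l _|/=|//]; first exact: ltry.
by rewrite gt0_muley// lte_fin invr_gt0.
Qed.

(** With [Z = mom 0], almost everywhere on the support [log (p_q / p_q') = (q - q') L + ln (Z q' / Z
    q)]. *)
Lemma KL_escort q q' : finite_log_moment2 mu p1 p0 q ->
  finite_log_moment2 mu p1 p0 q' ->
  (KL mu (escort mu p1 p0 q) (escort mu p1 p0 q') =
  \int[mu]_x (tlt 0 q x / mom 0 q * ((q - q') * escort_log x
     + ln (mom 0 q' / mom 0 q)))%:E)%E.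
Proof.
move=> hq hq'; apply: ae_eq_integral => //.
- apply: emeasurable_funM.
    by apply/measurable_EFinP; exact: (nonneg_measurable_escort q).1.
  by apply: measurable_log_ratio; exact: nonneg_measurable_escort.
- apply/measurable_EFinP; apply: measurable_funM.
    apply: measurable_funM => //.
    exact: measurable_tilt measurable_escort_base measurable_escort_log 0 q.
  apply: measurable_funD => //; apply: measurable_funM => //.
  exact: measurable_escort_log.
have Z_gt0 := moment0_gt0 q hq; have Z'_gt0 := moment0_gt0 q' hq'.
move: (ae_escort_weight_tilt q hq) (ae_escort_weight_tilt q' hq').
apply: filterS2 => x wx wx' _.
rewrite log_ratioE ?(nonneg_measurable_escort _).2//.
rewrite /escort -!moment0_escort// wx wx'.
(* Off the support both integrands are 0, whatever the log-ratio. A nonzero tilt at one parameter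
   forces [escort_base x > 0], hence positive tilts at all parameters. *)
have [->|t0] := eqVneq (tlt 0 q x / mom 0 q) 0; first by rewrite !mul0r mul0e.
have b_neq0 : escort_base x != 0.
  by apply: contra_neq t0; rewrite /tilt => ->; rewrite !(mul0r, mulr0).
have b_gt0 : 0 < escort_base x by rewrite lt0r b_neq0 escort_base_ge0.
have t_gt0 u : 0 < tlt 0 u x by rewrite /tilt expr0 mul1r mulr_gt0// expR_gt0.
rewrite gt_eqF ?divr_gt0//= -EFinM; congr (_ * _)%:E.
rewrite (_ : _ / _ / _ = expR ((q - q') * escort_log x) * (mom 0 q' / mom 0 q)).
  by rewrite lnM ?posrE ?expR_gt0 ?divr_gt0// expRK.
rewrite mulrBl expRD expRN /tilt !expr0 !mul1r; field.
by rewrite !gt_eqF ?expR_gt0.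
Qed.

End EscortTilt.

(** * Fisher information and Jeffreys divergence of the escort path *)

Section FisherJeffreys.
Context {d : measure_display} {T : measurableType d} {R : realType}.
Variables (mu : {measure set T -> \bar R}) (p1 p0 : T -> R).
Hypothesis hp1 : prob_density mu p1.
Hypothesis hp0 : nonneg_measurable p0.
Hypothesis hac : abs_cont mu p1 p0.
Variables r s : R.
Hypothesis r_ge0 : 0 <= r.
Hypothesis rs : r < s.
Hypothesis hmom : forall q, r <= q -> q <= s -> finite_log_moment2 mu p1 p0 q.

Local Notation B := (escort_base p1 p0).
Local Notation L := (escort_log p1 p0).
Let mB : measurable_fun setT B := measurable_escort_base mu p1 p0 hp1 hp0.
Let mL : measurable_fun setT L := measurable_escort_log mu p1 p0 hp1 hp0.
Let hr : finite_log_moment2 mu p1 p0 r := hmom r (lexx r) (ltW rs).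
Let hs : finite_log_moment2 mu p1 p0 s := hmom s (ltW rs) (lexx s).
Let int0r := integrable_tilt0 mu p1 p0 hp1 hp0 hac r hr.
Let int0s := integrable_tilt0 mu p1 p0 hp1 hp0 hac s hs.
Let int2r := integrable_tilt2 mu p1 p0 hp1 hp0 hac r hr.
Let int2s := integrable_tilt2 mu p1 p0 hp1 hp0 hac s hs.
Let Z_gt0 q (rq : r <= q) (qs : q <= s) : 0 < moment mu B L 0 q :=
  moment0_gt0 mu p1 p0 hp1 hp0 hac q (hmom q rq qs).
Let Z_neq0 q : r <= q <= s -> moment mu B L 0 q != 0.
Proof. by move=> /andP[rq qs]; rewrite gt_eqF// Z_gt0. Qed.

Local Notation mean := (tilted_mean mu B L).
Local Notation variance := (tilted_variance mu B L).

(** The score of an exponential family is [L] minus its mean. The formula holds at every [x];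
    [q = 1] is excluded because where [p0 = 0 < p1] the weight is positive at 1 and 0 at nearby
    parameters. *)
Lemma is_derive_escort (q : R) x : q \in `]r, s[ -> q != 1 ->
  is_derive q 1 (escort mu p1 p0 ^~ x) (escort mu p1 p0 q x * (L x - mean q)).
Proof.
move=> qrs q1.
have escortE u : u \in `]r, s[ -> u != 1 ->
    tilt B L 0 u x / moment mu B L 0 u = escort mu p1 p0 u x.
  rewrite in_itv/= => /andP[ru us] u1.
  rewrite /escort -(moment0_escort mu p1 p0 hp1 hp0 hac).
    rewrite (escort_weight_tilt mu p1 p0 hp1 hp0)// => u0.
      by move: ru; rewrite u0 ltNge r_ge0.
    by rewrite u0 eqxx in u1.
  by apply: hmom; exact: ltW.
have Zq : moment mu B L 0 q != 0.
  by apply: Z_neq0; move: qrs; rewrite in_itv/= => /andP[/ltW-> /ltW->].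
(* Parameters near [q] stay positive and different from 1, so there the escort density is exactly
   the normalized tilt. *)
apply: (@near_eq_is_derive _ _ _
    (fun u => tilt B L 0 u x * (moment mu B L 0 u)^-1)).
  near=> u; apply: escortE; first by near: u; exact: near_in_itvoo.
  by near: u; apply: open_neq.
have d0 := is_derive_moment mu B L mB mL r s 0 q qrs int0r int0s
  (integrable_tilt1 mu B L mB mL r int0r int2r)
  (integrable_tilt1 mu B L mB mL s int0s int2s).
have dV := is_deriveV Zq d0.
have dt := is_derive_tilt B L 0 q x.
apply: is_derive_eq; rewrite -escortE// /GRing.scale/= /tilted_mean.
by rewrite /tilt; field; exact: Zq.
Unshelve. all: by end_near. Qed.

(** The integrand becomes the density times the squared score. As [q > r >= 0], the derivative is
    two-sided. *)
Lemma fisher_info_escort (q : R) : q \in `]r, s[ -> q != 1 ->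
  fisher_info mu p1 p0 q = (variance q)%:E.
Proof.
move=> qrs q1; have /andP[rq qs] : r < q < s by move: qrs; rewrite in_itv.
rewrite -(integral_tilt_variance mu B L mB mL r s)//; last by rewrite !ltW.
apply: eq_integral => x _; congr EFin.
rewrite /param_derive (le_lt_trans r_ge0 rq) derive1E.
rewrite (@derive_val _ _ _ _ _ _ _ (is_derive_escort q x qrs q1)).
rewrite -(escort_weight_tilt mu p1 p0 hp1 hp0).
- rewrite (moment0_escort mu p1 p0 hp1 hp0 hac) -/(escort mu p1 p0 q x).
    (* Where the density is 0, the convention for the integrand agrees with the product, which is
       0. *)
    by have [->|e0] := eqVneq (escort mu p1 p0 q x) 0; [rewrite mul0r|field].
  by apply: hmom; exact: ltW.
- by move=> q0; move: rq; rewrite q0 ltNge r_ge0.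
- by move=> q1'; rewrite q1' eqxx in q1.
Qed.

Lemma integral_fisher_info :
  (\int[lebesgue_measure]_(q in `[r, s]) fisher_info mu p1 p0 q
   = (mean s - mean r)%:E)%E.
Proof.
rewrite -(integral_tilted_variance mu B L mB mL r s)//.
(* At q = 1 the escort curve is discontinuous where p0 = 0 < p1. *)
apply: (@integral_itv_eq_off_point _ _ _ 1); last exact: fisher_info_escort.
apply/measurable_EFinP.
apply: (@measurable_funS _ _ _ _ `[r, s]%classic) => //.
  exact: subset_itv_oo_cc.
apply: subspace_continuous_measurable_fun => //.
exact: (continuous_tilted_mean_variance mu B L mB mL r s _ _ _ _ _ _).2.
Qed.

(** In the sum of the two divergences the logarithms of the normalizers cancel, leaving
    [(s - r) mean s + (r - s) mean r]. *)
Lemma Jeffreys_escort :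
  (Jeffreys mu (escort mu p1 p0 s) (escort mu p1 p0 r)
   = ((s - r) * (mean s - mean r))%:E)%E.
Proof.
have KLE q q' : r <= q <= s -> r <= q' <= s ->
    KL mu (escort mu p1 p0 q) (escort mu p1 p0 q') =
    ((q - q') * mean q + ln (moment mu B L 0 q' / moment mu B L 0 q))%:E.
  move=> rqs /andP[rq' q's]; have /andP[rq qs] := rqs.
  rewrite (KL_escort mu p1 p0 hp1 hp0 hac q q' (hmom q rq qs) (hmom q' rq' q's)).
  exact: (integral_tilt_affine mu B L mB mL r s int0r int0s int2r int2s Z_neq0).
have rr : r <= r <= s by rewrite lexx ltW.
have ss : r <= s <= s by rewrite lexx ltW.
rewrite /Jeffreys (KLE s r ss rr) (KLE r s rr ss) -EFinD; congr EFin.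
have := Z_gt0 r (lexx r) (ltW rs); have := Z_gt0 s (ltW rs) (lexx s).
move: (moment _ _ _ 0 r) (moment _ _ _ 0 s) (mean r) (mean s) => Zr Zs a b.
by move=> Zs0 Zr0; rewrite !ln_div//; ring.
Qed.

End FisherJeffreys.

(** * Escort densities of index 0 and 1, and the degenerate interval *)

Lemma escort0 d (T : measurableType d) (R : realType)
    (mu : {measure set T -> \bar R}) (p1 p0 : T -> R) :
  prob_density mu p0 -> escort mu p1 p0 0 = p0.
Proof.
move=> [[_ p0_ge0] p0_int1].
have w0 : escort_weight p1 p0 0 = p0.
  by apply/funext => x; rewrite /escort_weight powRr0 mul1r subr0 powRr1.
by apply/funext => x; rewrite /escort /escort_mass w0 p0_int1 divr1.
Qed.

Lemma escort1 d (T : measurableType d) (R : realType)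
    (mu : {measure set T -> \bar R}) (p1 p0 : T -> R) :
  prob_density mu p1 -> escort mu p1 p0 1 = p1.
Proof.
move=> [[_ p1_ge0] p1_int1].
have w1 : escort_weight p1 p0 1 = p1.
  by apply/funext => x; rewrite /escort_weight subrr powRr0 mulr1 powRr1.
by apply/funext => x; rewrite /escort /escort_mass w1 p1_int1 divr1.
Qed.

Lemma KL_diag d (T : measurableType d) (R : realType)
    (mu : {measure set T -> \bar R}) (f : T -> R) :
  (forall x, 0 <= f x) -> KL mu f f = 0%E.
Proof.
move=> f0; apply: integral0_eq => x _; rewrite log_ratioE//.
by have [->|fx] := eqVneq (f x) 0; rewrite ?mul0e// divff// ln1 mule0.
Qed.

Theorem theorem11 (d : measure_display) (T : measurableType d) (R : realType)
    (mu : {measure set T -> \bar R}) (p1 p0 : T -> R)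
    (hp1 : prob_density mu p1) (hp0 : nonneg_measurable p0)
    (hac : abs_cont mu p1 p0) :
  (forall r s : R, 0 <= r -> r <= s ->
     (forall q : R, r <= q -> q <= s -> finite_log_moment2 mu p1 p0 q) ->
     ((s - r)%:E * \int[lebesgue_measure]_(q in `[r, s]) fisher_info mu p1 p0 q
      = Jeffreys mu (escort mu p1 p0 s) (escort mu p1 p0 r))%E)
  /\
  (prob_density mu p0 ->
     (forall q : R, 0 <= q -> q <= 1 -> finite_log_moment2 mu p1 p0 q) ->
     (\int[lebesgue_measure]_(q in `[0%R, 1%R]) fisher_info mu p1 p0 q
      = Jeffreys mu p1 p0)%E).
Proof.
have main r s : 0 <= r -> r <= s ->
    (forall q : R, r <= q -> q <= s -> finite_log_moment2 mu p1 p0 q) ->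
    ((s - r)%:E * \int[lebesgue_measure]_(q in `[r, s]) fisher_info mu p1 p0 q
      = Jeffreys mu (escort mu p1 p0 s) (escort mu p1 p0 r))%E.
  move=> r0; rewrite le_eqVlt => /predU1P[<- _|rs hmom].
    (* For [r = s] both sides are 0: on the left, 0 times any extended real is 0. *)
    rewrite subrr mul0e /Jeffreys KL_diag ?adde0// => x.
    exact: (nonneg_measurable_escort mu p1 p0 hp1 hp0 r).2.
  by rewrite Jeffreys_escort// integral_fisher_info.
split=> // hp0' /(main 0 1 (lexx 0) ler01).
by rewrite escort1// escort0// subr0 mul1e.
Qed.
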